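(* Let $Q$ be a finite acyclic quiver and let $X$ be a finite-dimensional complex representation of $Q$ which can be lifted to a representation $\hat X$ of the universal abelian covering quiver $\hat Q$, so that $X_i=\bigoplus_{\chi\in A_Q}X_{(i,\chi)}$ with $X_{(i,\chi)}:=\hat X_{(i,\chi)}$ for every $i\in Q_0$. Then there exists a map $d:\operatorname{supp}(\hat X)\to\mathbb{Z}$ such that the $\mathbb{C}^*$-action on each $X_i$ determined by linearity and $t.x_{(i,\chi)}=t^{d(i,\chi)}x_{(i,\chi)}$ for $x_{(i,\chi)}\in X_{(i,\chi)}$ induces, for each dimension vector $\mathbf{e}\in\mathbb{N}^{Q_0}$, a $\mathbb{C}^*$-action on the quiver Grassmannian $\mathrm{Gr}^Q_{\mathbf e}(X)$ (via $U=(U_i)_{i}\mapsto t.U=(t.U_i)_i$) with $$\mathrm{Gr}^Q_{\mathbf e}(X)^{\mathbb{C}^*}\cong\bigsqcup_{\hat{\mathbf e}}\mathrm{Gr}^{\hat Q}_{\hat{\mathbf e}}(\hat X),$$ where $\hat{\mathbf e}$ runs through all dimension vectors of $\hat Q$ compatible with $\mathbf e$.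
   Context: A quiver $Q$ has vertex set $Q_0$ and arrow set $Q_1$, with arrows $\alpha:s(\alpha)\to t(\alpha)$. $A_Q\cong\mathbb{Z}^{Q_1}$ is the free abelian group generated by $Q_1$, with generator $e_\alpha$ for $\alpha\in Q_1$. The universal abelian covering quiver $\hat Q$ has vertices $\hat Q_0=Q_0\times A_Q$ and arrows $\hat Q_1=Q_1\times A_Q$, where $(\alpha,\chi):(s(\alpha),\chi)\to(t(\alpha),\chi+e_\alpha)$. The natural functor $F_Q:\operatorname{rep}\hat Q\to\operatorname{rep}Q$ sends $\hat X$ to the representation with $(F_Q\hat X)_i=\bigoplus_{\chi\in A_Q}\hat X_{(i,\chi)}$ and with the map of $\alpha$ being the block map with components $\hat X_{(\alpha,\chi)}$. A representation $X$ of $Q$ can be lifted to $\hat Q$ if $X=F_Q\hat X$ for some finite-dimensional $\hat X\in\operatorname{rep}\hat Q$. The support $\operatorname{supp}(\hat X)$ is the set of vertices $(i,\chi)$ with $\hat X_{(i,\chi)}\ne0$. A dimension vector $\hat{\mathbf e}$ of $\hat Q$ is compatible with $\mathbf e$ if $\sum_{\chi}\hat{\mathbf e}_{(i,\chi)}=\mathbf e_i$ for all $i\in Q_0$. The quiver Grassmannian $\mathrm{Gr}^Q_{\mathbf e}(X)$ is the projective variety of subrepresentations of $X$ of dimension vector $\mathbf e$ (and similarly for $\hat Q$). *)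

(* Defs.v *)
From HB Require Import structures.
From mathcomp Require Import all_boot all_order all_algebra.
From mathcomp Require Import finmap.
From mathcomp Require Import reals.
From mathcomp Require Export complex.

Set Implicit Arguments.
Unset Strict Implicit.
Unset Printing Implicit Defensive.

Import GRing.Theory VectorInternalTheory.
Local Open Scope ring_scope.

Section DirectSum.
Variables (K : fieldType) (T : choiceType) (s : {fset T}) (V : T -> vectType K).

Definition dsum : Type := {dffun forall x : s, V (val x)}.

HB.instance Definition _ := Choice.on dsum.

Implicit Types f g h : dsum.

Definition dsum_add f g : dsum := [ffun x => f x + g x].
Definition dsum_opp f : dsum := [ffun x => - f x].
Definition dsum_zero : dsum := [ffun x => 0].
Definition dsum_scale (a : K) f : dsum := [ffun x => a *: f x].

Fact dsum_addA : associative dsum_add.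
Proof. by move=> f g h; apply/ffunP=> x; rewrite !ffunE addrA. Qed.
Fact dsum_addC : commutative dsum_add.
Proof. by move=> f g; apply/ffunP=> x; rewrite !ffunE addrC. Qed.
Fact dsum_add0 : left_id dsum_zero dsum_add.
Proof. by move=> f; apply/ffunP=> x; rewrite !ffunE add0r. Qed.
Fact dsum_addN : left_inverse dsum_zero dsum_opp dsum_add.
Proof. by move=> f; apply/ffunP=> x; rewrite !ffunE addNr. Qed.

HB.instance Definition _ :=
  GRing.isZmodule.Build dsum dsum_addA dsum_addC dsum_add0 dsum_addN.

Fact dsum_scaleA a b f : dsum_scale a (dsum_scale b f) = dsum_scale (a * b) f.
Proof. by apply/ffunP=> x; rewrite !ffunE scalerA. Qed.
Fact dsum_scale1 : left_id 1 dsum_scale.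
Proof. by move=> f; apply/ffunP=> x; rewrite !ffunE scale1r. Qed.
Fact dsum_scaleDr : right_distributive dsum_scale +%R.
Proof. by move=> a f g; apply/ffunP=> x; rewrite !ffunE scalerDr. Qed.
Fact dsum_scaleDl f : {morph dsum_scale^~ f : a b / a + b}.
Proof. by move=> a b; apply/ffunP=> x; rewrite !ffunE scalerDl. Qed.

HB.instance Definition _ := GRing.Zmodule_isLmodule.Build K dsum
  dsum_scaleA dsum_scale1 dsum_scaleDr dsum_scaleDl.

Lemma dsumDE f g x : (f + g) x = f x + g x. Proof. exact: ffunE. Qed.
Lemma dsumZE a f x : (a *: f) x = a *: f x. Proof. exact: ffunE. Qed.

Let dsum_idx : finType := {x : s & 'I_(dim (V (val x)))}.

Fact dsum_vect_iso : Vector.axiom #|dsum_idx| dsum.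
Proof.
pose fr f := \row_(k < #|dsum_idx|)
  v2r (f (tag (enum_val k))) 0 (tagged (enum_val k)).
exists fr => [a f g|].
  by apply/rowP=> k; rewrite !mxE dsumDE dsumZE linearP !mxE.
pose df (r : 'rV_#|dsum_idx|) : dsum := [ffun x : s =>
  r2v (\row_j r 0 (enum_rank (Tagged (fun y : s => 'I_(dim (V (val y)))) j)))].
exists df => [f|r].
  apply/ffunP=> x; rewrite ffunE; apply: (can_inj v2rK); rewrite r2vK.
  by apply/rowP=> j; rewrite !mxE enum_rankK.
apply/rowP=> k; rewrite !mxE ffunE r2vK mxE.
by congr (r 0 _); apply: (can_inj enum_valK); rewrite enum_rankK; case: enum_val.
Qed.

HB.instance Definition _ := Lmodule_hasFinDim.Build K dsum dsum_vect_iso.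

Definition dsum_proj (x : s) (f : dsum) : V (val x) := f x.

(* Zero when [x] is not in [s]. *)
Definition dsum_in (x : T) (u : V x) : dsum :=
  [ffun y : s => (if x =P val y is ReflectT e then ecast z (V z) e u else 0)
                   : V (val y)].

Definition dsum_diag (c : s -> K) (f : dsum) : dsum := [ffun x => c x *: f x].

Fact dsum_proj_linear x : linear (dsum_proj x).
Proof. by move=> a f g; rewrite /dsum_proj dsumDE dsumZE. Qed.

HB.instance Definition _ x := GRing.isLinear.Build K dsum (V (val x)) *:%R
  (dsum_proj x) (dsum_proj_linear x).

Fact dsum_in_linear x : linear (@dsum_in x).
Proof.
move=> a u w; apply/ffunP=> y; rewrite dsumDE dsumZE !ffunE.
case: eqP => [e|_]; last by rewrite scaler0 addr0.
by case: _ / e.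
Qed.

HB.instance Definition _ x := GRing.isLinear.Build K (V x) dsum *:%R
  (@dsum_in x) (@dsum_in_linear x).

Fact dsum_diag_linear c : linear (dsum_diag c).
Proof.
move=> a f g; apply/ffunP=> x.
by rewrite dsumDE dsumZE !ffunE scalerDr !scalerA mulrC.
Qed.

HB.instance Definition _ c := GRing.isLinear.Build K dsum dsum *:%R
  (dsum_diag c) (dsum_diag_linear c).

End DirectSum.

Record quiver := Quiver {
  vertex : choiceType;
  arrow : choiceType;
  src : arrow -> vertex;
  tgt : arrow -> vertex
}.

Record finQuiver := FinQuiver {
  fvertex : finType;
  farrow : finType;
  fsrc : farrow -> fvertex;
  ftgt : farrow -> fvertex
}.

Definition quiver_of_finQuiver (Q : finQuiver) : quiver :=
  @Quiver (fvertex Q) (farrow Q) (@fsrc Q) (@ftgt Q).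
Coercion quiver_of_finQuiver : finQuiver >-> quiver.

Definition acyclic (Q : quiver) : Prop :=
  forall p : seq (arrow Q), p != [::] -> ~~ cycle (fun a b => tgt a == src b) p.

Record rep (K : fieldType) (Q : quiver) := Rep {
  rspace :> vertex Q -> vectType K;
  rmap : forall a : arrow Q, 'Hom(rspace (src a), rspace (tgt a))
}.

Record fdrep (K : fieldType) (Q : quiver) := FdRep {
  fdrep_rep :> rep K Q;
  supp : {fset vertex Q};
  suppP : forall v, (v \in supp) = (\dim {:fdrep_rep v} != 0)%N
}.

Definition charGroup (Q : finQuiver) : zmodType := {ffun farrow Q -> int}.

Definition char_gen (Q : finQuiver) (a : farrow Q) : charGroup Q :=
  [ffun b => (b == a)%:R].

Definition coverQuiver (Q : finQuiver) : quiver :=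
  @Quiver (fvertex Q * charGroup Q)%type (farrow Q * charGroup Q)%type
    (fun ac => (fsrc ac.1, ac.2))
    (fun ac => (ftgt ac.1, ac.2 + char_gen ac.1)).

Section PushDown.
Variables (K : fieldType) (Q : finQuiver) (X : fdrep K (coverQuiver Q)).

Definition supp_fiber (i : fvertex Q) : {fset charGroup Q} :=
  [fset v.2 | v in supp X & v.1 == i]%fset.

Fact supp_fiberP i (c : supp_fiber i) : (i, val c) \in supp X.
Proof.
by case: c => c /= /imfsetP[[j c'] /= /andP[vX /eqP ij] ->]; rewrite -ij.
Qed.

Definition push_space (i : fvertex Q) : vectType K :=
  dsum (supp_fiber i) (fun c => X (i, c)).

Definition push_map (a : farrow Q) :
    'Hom(push_space (fsrc a), push_space (ftgt a)) :=
  \sum_(c : supp_fiber (fsrc a))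
    (linfun (@dsum_in _ _ (supp_fiber (ftgt a)) (fun c' => X (ftgt a, c'))
               (val c + char_gen a))
     \o @rmap K (coverQuiver Q) X (a, val c)
     \o linfun (@dsum_proj _ _ _ (fun c' => X (fsrc a, c')) c))%VF.

Definition push : rep K Q := @Rep K Q push_space push_map.

Definition weight_act (d : supp X -> int) (t : K) (i : vertex Q) :
    'End(push i) :=
  linfun (@dsum_diag K _ (supp_fiber i) (fun c => X (i, c))
            (fun c => t ^ d [` supp_fiberP c]%fset)).

End PushDown.

(* A dimension vector of the covering quiver has finite support, so that the
   sum over all characters is a finite one. *)
Definition compatible (Q : finQuiver) (e : vertex Q -> nat)
    (e' : {fsfun vertex (coverQuiver Q) -> nat with 0%N}) : Prop :=
  forall i : vertex Q, (\sum_(v <- finsupp e' | v.1 == i) e' v)%N = e i.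

(* [sregular W f]: the restriction of [f] to the open set [W] is a regular
   function; the values of [f] outside [W] are irrelevant. *)
Record funSpace (K : fieldType) := FunSpace {
  spoint :> Type;
  sopen : (spoint -> Prop) -> Prop;
  sregular : (spoint -> Prop) -> (spoint -> K) -> Prop
}.

Definition space_morphism (K : fieldType) (S S' : funSpace K)
    (phi : S -> S') : Prop :=
  forall W : S' -> Prop, sopen W ->
    sopen (fun x => W (phi x)) /\
    forall f : S' -> K, sregular W f ->
      sregular (fun x => W (phi x)) (fun x => f (phi x)).

Definition isomorphic (K : fieldType) (S S' : funSpace K) : Prop :=
  exists (phi : S -> S') (psi : S' -> S),
    [/\ cancel phi psi, cancel psi phi, space_morphism phi & space_morphism psi].

Definition disjoint_union (K : fieldType) (I : Type) (S : I -> funSpace K) :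
    funSpace K :=
  @FunSpace K {i : I & S i}
    (fun W => forall i, sopen (fun x : S i => W (existT _ i x)))
    (fun W f => forall i, sregular (fun x : S i => W (existT _ i x))
                                   (fun x : S i => f (existT _ i x))).

(* A set of points of a product of projective and affine spaces.  [hlift x r]
   says that [r] provides multihomogeneous coordinates for the point [x], and
   [hcoord n f] that [f] is a coordinate function of multidegree [n]; affine
   coordinates have multidegree 0. *)
Record hset (K : fieldType) := HSet {
  hpoint : Type;
  hrep : Type;
  hlift : hpoint -> hrep -> Prop;
  hfactor : Type;
  hcoord : (hfactor -> nat) -> (hrep -> K) -> Prop
}.

Section Zariski.
Variables (K : fieldType) (S : hset K).

Inductive hpoly : (hfactor S -> nat) -> (hrep S -> K) -> Prop :=
| hpoly_const (a : K) : hpoly (fun=> 0%N) (fun=> a)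
| hpoly_coord n f : hcoord n f -> hpoly n f
| hpoly_add n f g : hpoly n f -> hpoly n g -> hpoly n (fun r => f r + g r)
| hpoly_mul m n f g : hpoly m f -> hpoly n g ->
    hpoly (fun k => m k + n k)%N (fun r => f r * g r).

Definition zariski_closed (Z : hpoint S -> Prop) : Prop :=
  exists F : (hrep S -> K) -> Prop,
    (forall f, F f -> exists n, hpoly n f) /\
    forall x, Z x <-> forall f, F f -> forall r, hlift x r -> f r = 0.

Definition zariski_open (W : hpoint S -> Prop) : Prop :=
  zariski_closed (fun x => ~ W x).

Definition zariski_regular (W : hpoint S -> Prop) (f : hpoint S -> K) : Prop :=
  forall x, W x -> exists V : hpoint S -> Prop,
    [/\ zariski_open V, V x, (forall y, V y -> W y) &
      exists n p q, [/\ hpoly n p, hpoly n q &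
        forall y r, V y -> hlift y r -> q r != 0 /\ f y = p r / q r]].

Definition variety : funSpace K :=
  @FunSpace K (hpoint S) zariski_open zariski_regular.

Definition sublocus (P : hpoint S -> Prop) : hset K :=
  @HSet K {x : hpoint S | P x} (hrep S) (fun x => hlift (sval x))
    (hfactor S) (@hcoord K S).

Definition Gm : Type := {t : K | t != 0}.

Definition Gm1 : Gm := exist _ 1 (oner_neq0 K).

Definition Gm_mul (t u : Gm) : Gm :=
  exist _ (sval t * sval u) (mulf_neq0 (svalP t) (svalP u)).

Inductive Gm_prod_coord :
    (hfactor S -> nat) -> (Gm * hrep S -> K) -> Prop :=
| Gm_prod_coord_fst : Gm_prod_coord (fun=> 0%N) (fun tr => sval tr.1)
| Gm_prod_coord_snd n f : hcoord n f -> Gm_prod_coord n (fun tr => f tr.2).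

Definition Gm_prod : hset K :=
  @HSet K (Gm * hpoint S) (Gm * hrep S)
    (fun tx tr => tx.1 = tr.1 /\ hlift tx.2 tr.2) (hfactor S) Gm_prod_coord.

End Zariski.

Definition algebraic_Gm_action (K : fieldType) (S : hset K)
    (act : Gm K -> hpoint S -> hpoint S) : Prop :=
  [/\ forall x, act (Gm1 K) x = x,
      forall t u x, act (Gm_mul t u) x = act t (act u x) &
      @space_morphism K (variety (Gm_prod S)) (variety S)
        (fun tx => act tx.1 tx.2)].

Definition fixed_locus (K : fieldType) (S : hset K)
    (act : Gm K -> hpoint S -> hpoint S) : funSpace K :=
  variety (sublocus (fun x => forall t, act t x = x)).

Section QuiverGrassmannian.
Variables (K : fieldType) (Q : quiver) (X : rep K Q) (e : vertex Q -> nat).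

Definition subrep (U : forall v, {vspace X v}) : Prop :=
  forall a : arrow Q, (rmap X a @: U (src a) <= U (tgt a))%VS.

Definition gr_point : Type :=
  {U : forall v, {vspace X v} | subrep U /\ forall v, \dim (U v) = e v}.

Definition frames : Type := forall v, (e v).-tuple (X v).

Definition pluecker (v : vertex Q) (I : 'I_(e v) -> 'I_(\dim {:X v}))
    (b : frames) : K :=
  \det (\matrix_(j < e v, k < e v) coord (vbasis {:X v}) (I k) (tnth (b v) j)).

Inductive pluecker_coord : (vertex Q -> nat) -> (frames -> K) -> Prop :=
  PlueckerCoord v I : pluecker_coord (fun w => (w == v) : nat) (@pluecker v I).

(* The quiver Grassmannian inside the product over the vertices of the
   Grassmannians of the [X v], each in its Pluecker embedding. *)
Definition quiverGr : hset K :=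
  @HSet K gr_point frames (fun U b => forall v, basis_of (sval U v) (b v))
    (vertex Q) pluecker_coord.

End QuiverGrassmannian.

(* Main.v *)
Require Import Defs.
From HB Require Import structures.
From mathcomp Require Import all_boot all_order all_algebra.
From mathcomp Require Import perm finmap.
From mathcomp Require Import boolp reals complex.

Set Implicit Arguments.
Unset Strict Implicit.
Unset Printing Implicit Defensive.

Import Order.TTheory GRing.Theory Num.Theory VectorInternalTheory.
Local Open Scope ring_scope.

(* Let the torus act on [X_(i,chi)] with weight [d(chi)], where [d] is a linear
   form on the character group, injective on the characters of the support, plus
   a constant. Linearity makes every arrow equivariant up to a power of [t], so
   subrepresentations are moved to subrepresentations; injectivity makes the
   [X_(i,chi)] the weight spaces of [X_i], so the fixed points are the graded
   subrepresentations, that is, the subrepresentations of the lift.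

   That these bijections are morphisms is checked on local frames: near a point
   where the Pluecker coordinate [p_I] does not vanish, Cramer's rule gives a
   basis of the subspace whose entries are the Pluecker coordinates
   [p_(I with one index replaced)]. Every map in question sends such frames to
   frames with multihomogeneous entries, and minors of these are again
   multihomogeneous. Nearby fixed points have the same graded dimension vector
   because each graded dimension is lower semicontinuous and their sum is
   constant. *)

(** * Multihomogeneous polynomials *)

Section HPoly.
Variables (K : fieldType) (S : hset K).
Implicit Types (m n : hfactor S -> nat) (f g : hrep S -> K).

Lemma hpoly_eq m n f g : hpoly m f -> m =1 n -> f =1 g -> hpoly n g.
Proof. by move=> h /funext <- /funext <-. Qed.

Lemma hpoly_scale m f a : hpoly m f -> hpoly m (fun r => a * f r).
Proof. by move=> hf; apply: hpoly_eq (hpoly_mul (hpoly_const S a) hf) _ _. Qed.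

(** [hpoly_const] provides constants in multidegree 0 only, so the zero function of multidegree [m]
    is obtained by scaling a known function of that multidegree. *)
Lemma hpoly_zero m f : hpoly m f -> hpoly m (fun=> 0).
Proof. by move=> /(hpoly_scale 0) h; apply: hpoly_eq h _ _ => // r; rewrite mul0r. Qed.

Lemma hpoly_sum m (I : Type) (s : seq I) (P : pred I) (F : I -> hrep S -> K) :
  hpoly m (fun=> 0) -> (forall i, P i -> hpoly m (F i)) ->
  hpoly m (fun r => \sum_(i <- s | P i) F i r).
Proof.
move=> h0 hF; elim: s => [|i s IHs].
  by apply: hpoly_eq h0 _ _ => // r; rewrite big_nil.
case Pi: (P i); last by apply: hpoly_eq IHs _ _ => // r; rewrite big_cons Pi.
by apply: hpoly_eq (hpoly_add (hF i Pi) IHs) _ _ => // r; rewrite big_cons Pi.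
Qed.

Lemma hpoly_prod (I : Type) (s : seq I) (m : I -> hfactor S -> nat)
    (F : I -> hrep S -> K) :
  (forall i, hpoly (m i) (F i)) ->
  hpoly (fun k => \sum_(i <- s) m i k)%N (fun r => \prod_(i <- s) F i r).
Proof.
move=> hF; elim: s => [|i s IHs].
  by apply: hpoly_eq (hpoly_const S 1) _ _ => r; rewrite big_nil.
by apply: hpoly_eq (hpoly_mul (hF i) IHs) _ _ => r; rewrite big_cons.
Qed.

(** The multidegree of an entry depends on its row only, so all Leibniz terms have the same
    multidegree. *)
Lemma hpoly_det d (m : 'I_d -> hfactor S -> nat) (A : hrep S -> 'M[K]_d) :
  (forall j k, hpoly (m j) (fun r => A r j k)) ->
  hpoly (fun k => \sum_j m j k)%N (fun r => \det (A r)).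
Proof.
move=> hA; have hp (s : 'S_d) := hpoly_prod (index_enum _) (fun j => hA j (s j)).
rewrite /determinant; apply: hpoly_sum => [|s _]; first exact: hpoly_zero (hp 1%g).
exact: hpoly_scale (hp s).
Qed.

(* Testing against all linear forms makes this notion independent of a basis and
   stable under linear maps. *)
Definition hvec (V : vectType K) m (F : hrep S -> V) : Prop :=
  forall l : 'Hom(V, K^o), hpoly m (fun r => l (F r)).

Lemma hvec_lfun (V V' : vectType K) m (F : hrep S -> V) (u : 'Hom(V, V')) :
  hvec m F -> hvec m (fun r => u (F r)).
Proof.
move=> hF l; apply: hpoly_eq (hF (l \o u)%VF) _ _ => // r.
by rewrite comp_lfunE.
Qed.

Lemma hvec_coord (V : vectType K) m (F : hrep S -> V) d (X : d.-tuple V) j :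
  hvec m F -> hpoly m (fun r => coord X j (F r)).
Proof.
move=> /(_ (linfun (coord X j : V -> K^o))) h.
by apply: hpoly_eq h _ _ => // r; rewrite lfunE.
Qed.

(** An [hset] does not record how two lifts of a point are related. This is the consequence of
    homogeneity used below: non-vanishing is independent of the lift. *)
Definition hhomog : Prop := forall n f x r r', hpoly n f ->
  hlift x r -> hlift x r' -> f r != 0 -> f r' != 0.

End HPoly.

(** * Pullback of multihomogeneous functions along a map of coordinates *)

Definition graded_pullback (K : fieldType) (S S' : hset K)
    (M : (hfactor S' -> nat) -> hfactor S -> nat) (tau : hrep S -> hrep S') : Prop :=
  [/\ M (fun=> 0%N) = fun=> 0%N,
      forall m n, M (fun k => m k + n k)%N = fun k => (M m k + M n k)%N &
      forall n f, @hcoord K S' n f -> hpoly (M n) (fun r => f (tau r))].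

Lemma hpoly_pullback (K : fieldType) (S S' : hset K) M (tau : hrep S -> hrep S') n f :
  graded_pullback M tau -> hpoly n f -> hpoly (M n) (fun r => f (tau r)).
Proof.
case=> M0 MD Mc; elim=> {n f} [a|n f /Mc//|n f g _ hf _ hg|m n f g _ hf _ hg].
- by rewrite M0; exact: hpoly_const.
- exact: hpoly_add.
- by rewrite MD; exact: hpoly_mul.
Qed.

(** The coordinates agree but [hpoly] is indexed by the [hset], so the identity serves as a pullback
    in both directions. *)
Lemma hpoly_sublocus (K : fieldType) (S : hset K) (P : hpoint S -> Prop) n f :
  @hpoly K S n f <-> @hpoly K (sublocus P) n f.
Proof.
split.
  apply: (@hpoly_pullback K (sublocus P) S id id); split=> // m g hg.
  exact: (@hpoly_coord K (sublocus P) m g hg).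
apply: (@hpoly_pullback K S (sublocus P) id id); split=> // m g hg.
exact: (@hpoly_coord K S m g hg).
Qed.

Lemma hvec_sublocus (K : fieldType) (S : hset K) (P : hpoint S -> Prop)
    (V : vectType K) n (F : hrep S -> V) :
  @hvec K S V n F -> @hvec K (sublocus P) V n F.
Proof. by move=> hF l; exact: (proj1 (hpoly_sublocus P _ _) (hF l)). Qed.

Lemma hhomog_sublocus (K : fieldType) (S : hset K) (P : hpoint S -> Prop) :
  hhomog S -> hhomog (sublocus P).
Proof.
move=> hS n f x r r' hf.
exact: (hS n f (sval x) r r' (proj2 (hpoly_sublocus P n f) hf)).
Qed.

Lemma hpoly_Gm_prod (K : fieldType) (S : hset K) n f :
  @hpoly K S n f -> @hpoly K (Gm_prod S) n (fun tr => f tr.2).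
Proof.
apply: (@hpoly_pullback K (Gm_prod S) S id snd); split=> // m g hg.
by apply: hpoly_coord; exact: Gm_prod_coord_snd.
Qed.

(** * A local criterion for morphisms *)

(** An open set is a union of basic ones. Conversely, the complement of [W] is cut out by all
    multihomogeneous functions that are nonzero only over points of [W]. *)
Lemma zariski_openP (K : fieldType) (S : hset K) (W : hpoint S -> Prop) :
  zariski_open W <->
  forall x, W x -> exists n f, [/\ hpoly n f, exists2 r, hlift x r & f r != 0 &
    forall y r, hlift y r -> f r != 0 -> W y].
Proof.
split=> [[F [hF WF]] x Wx|hW].
  have: ~ (forall f, F f -> forall r, hlift x r -> f r = 0) by move/WF.
  move=> /existsNP[f /not_implyP[Ff /existsNP[r /not_implyP[xr /eqP fr]]]].
  have [n hf] := hF f Ff; exists n, f; split=> // [|y r' yr' /eqP fr']; first by exists r.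
  by apply: contrapT => /WF/(_ f Ff r' yr').
exists (fun f => (exists n, hpoly n f) /\ forall y r, hlift y r -> f r != 0 -> W y).
split=> [f []//|x]; split=> [nWx f [_ fW] r xr|fx0 Wx].
  by apply/eqP; apply: contra_notT nWx; exact: fW xr.
have [n [f [hf [r xr /eqP fr] fW]]] := hW x Wx; apply: fr.
by apply: fx0 xr; split=> //; exists n.
Qed.

Section LocalCriterion.
Variables (K : fieldType) (S : hset K).

(** Independence of the lift is asked of [g] alone, so that a product with the torus can be treated
    through a function of its second factor. *)
Definition unit_at (x : hpoint S) (g : hrep S -> K) : Prop :=
  [/\ exists n, hpoly n g, exists2 r, hlift x r & g r != 0 &
      forall y r r', hlift y r -> hlift y r' -> g r != 0 -> g r' != 0].

Lemma unit_at_homog x n g r :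
  hhomog S -> hpoly n g -> hlift x r -> g r != 0 -> unit_at x g.
Proof.
move=> hS hg xr gr; split; [by exists n|by exists r|].
by move=> y r1 r2; apply: hS hg.
Qed.

(** Where [g] is nonzero, [phi] factors through [iota], and [tau] computes coordinates of the image;
    open sets and fractions are pulled back along [tau]. The intermediate [S'] allows [T] to be a
    disjoint union, whose points carry no coordinates. *)
Lemma local_morphism (T : funSpace K) (phi : hpoint S -> T) :
  (forall x, exists (S' : hset K) (iota : hpoint S' -> T) g
      (tau : hrep S -> hrep S') M,
    [/\ hhomog S', @space_morphism K (variety S') T iota /\ injective iota,
        graded_pullback M tau, unit_at x g &
        forall y r, hlift y r -> g r != 0 ->
          exists2 x', phi y = iota x' & hlift x' (tau r)]) ->
  @space_morphism K (variety S) T phi.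
Proof.
move=> hphi W oW.
have openW : zariski_open (fun x => W (phi x)).
  apply/zariski_openP => x Wx.
  have [S' [iota [g [tau [M [homS' [/(_ W oW)[+ _] _] hM]]]]]] := hphi x.
  move=> /zariski_openP oW' [[n hg] [r xr gr] _] htau.
  have [x' phix x'r] := htau x r xr gr; rewrite phix in Wx.
  have [n' [f [hf [r' x'r' fr'] fW]]] := oW' x' Wx.
  exists (fun k => n k + M n' k)%N, (fun r => g r * f (tau r)); split.
  - by apply: hpoly_mul hg _; exact: hpoly_pullback hM hf.
  (* [oW'] gives non-vanishing of [f] at some lift [r'] of [x']; [homS'] transfers it to the lift
     [tau r]. *)
  - by exists r => //; rewrite mulf_neq0 // (homS' _ _ _ _ _ hf x'r').
  - move=> y r1 yr1; rewrite mulf_eq0 negb_or => /andP[gr1 fr1].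
    by have [y' -> y'r1] := htau y r1 yr1 gr1; exact: fW fr1.
split=> // f fW x Wx.
have [S' [iota [g [tau [M [homS' [smi iotaI] hM]]]]]] := hphi x.
have [_ /(_ f fW) regf] := smi W oW.
move=> [[n hg] [r xr gr] gu] htau.
have [x' phix x'r] := htau x r xr gr; rewrite phix in Wx.
have [V [/zariski_openP oV Vx' VW [n' [p [q [hp hq pq]]]]]] := regf x' Wx.
exists (fun y => exists r', [/\ hlift y r', g r' != 0 &
  exists y', [/\ phi y = iota y', hlift y' (tau r') & V y']]); split.
- apply/zariski_openP => y [r1 [yr1 gr1 [y' [phiy y'r1 Vy']]]].
  have [n1 [h [hh [r' y'r' hr'] hV]]] := oV y' Vy'.
  exists (fun k => n k + M n1 k)%N, (fun r => g r * h (tau r)); split.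
  + by apply: hpoly_mul hg _; exact: hpoly_pullback hM hh.
  + by exists r1 => //; rewrite mulf_neq0 // (homS' _ _ _ _ _ hh y'r').
  + move=> z r2 zr2; rewrite mulf_eq0 negb_or => /andP[gr2 hr2].
    have [z' phiz z'r2] := htau z r2 zr2 gr2.
    by exists r2; split=> //; exists z'; split=> //; exact: hV hr2.
- by exists r; split=> //; exists x'.
- by move=> y [r1 [_ _ [y' [-> _ /VW]]]].
- exists (M n'), (fun r => p (tau r)), (fun r => q (tau r)).
  split; [exact: hpoly_pullback hM hp|exact: hpoly_pullback hM hq|].
  move=> y r2 [r1 [yr1 gr1 [y' [phiy y'r1 Vy']]]] yr2.
  (* The fraction must be evaluated at an arbitrary lift [r2], not at the lift [r1] that witnesses
     membership. Injectivity of [iota] identifies the two preimages of [phi y]. *)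
  have [z' phiz z'r2] := htau y r2 yr2 (gu _ _ _ yr1 yr2 gr1).
  have ezy : z' = y' by apply: iotaI; rewrite -phiz.
  by rewrite phiy; apply: pq => //; rewrite -ezy.
Qed.

End LocalCriterion.

Lemma space_morphism_inclusion (K : fieldType) (I : Type) (T : I -> funSpace K) i :
  @space_morphism K (T i) (disjoint_union T) (existT _ i).
Proof. by move=> W oW; split=> [|f]; [exact: oW|exact]. Qed.

Lemma space_morphism_copair (K : fieldType) (I : Type) (T : I -> funSpace K)
    (T' : funSpace K) (phi : disjoint_union T -> T') :
  (forall i, @space_morphism K (T i) T' (fun x => phi (existT _ i x))) ->
  space_morphism phi.
Proof.
move=> hphi W oW; split=> [i|f fW i]; first by have [] := hphi i W oW.
by have [_ /(_ f fW)] := hphi i W oW.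
Qed.

(** * Frames and Pluecker coordinates *)

Section CoordMatrix.
Variables (K : fieldType) (V : vectType K).

(** The Pluecker coordinates of a frame are the maximal minors of this matrix. *)
Definition coord_mx n (X : n.-tuple V) : 'M[K]_(n, \dim {:V}) :=
  \matrix_(j, l) coord (vbasis {:V}) l (tnth X j).

Definition lincomb m n (C : 'M[K]_(m, n)) (X : n.-tuple V) : m.-tuple V :=
  [tuple \sum_l C i l *: tnth X l | i < m].

Lemma coord_mx_lincomb m n (C : 'M_(m, n)) (X : n.-tuple V) :
  coord_mx (lincomb C X) = C *m coord_mx X.
Proof.
apply/matrixP=> i j; rewrite !mxE tnth_mktuple linear_sum.
by apply: eq_bigr => l _; rewrite linearZ mxE.
Qed.

Lemma tnth_coord_mx n (X : n.-tuple V) j :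
  tnth X j = \sum_l coord_mx X j l *: (vbasis {:V})`_l.
Proof.
by rewrite {1}(coord_vbasis (memvf (tnth X j))); apply: eq_bigr => l _; rewrite mxE.
Qed.

Lemma coord_mx_inj n : injective (@coord_mx n).
Proof. by move=> X Y XY; apply: eq_from_tnth => j; rewrite !tnth_coord_mx XY. Qed.

(** The internal matrix [b2mx X] is [coord_mx X] times that of [vbasis {:V}], which is row free. *)
Lemma mxrank_coord_mx n (X : n.-tuple V) : \rank (coord_mx X) = \dim <<X>>%VS.
Proof.
have dimE k (Y : k.-tuple V) : \dim <<Y>>%VS = \rank (b2mx Y).
  have -> : span Y = mx2vs (b2mx Y).
    by rewrite [span]unlock tvalK; case: _ / (esym _).
  by rewrite /dimv /= genmxE.
pose B := b2mx (vbasis {:V}).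
have freeB : row_free B.
  by rewrite /row_free -dimE (span_basis (vbasisP _)).
rewrite dimE -(mxrankMfree _ freeB); congr (\rank _).
apply/row_matrixP => i; rewrite rowK row_mul mulmx_sum_row tnth_coord_mx.
rewrite linear_sum; apply: eq_bigr => l _.
by rewrite linearZ /= [row l B]rowK [row i _ 0 l]mxE; congr (_ *: v2r _); rewrite (tnth_nth 0).
Qed.

Lemma free_coord_mx n (X : n.-tuple V) : free X = row_free (coord_mx X).
Proof. by rewrite /row_free mxrank_coord_mx /free size_tuple. Qed.

Lemma lincombK n (C : 'M_n) (X : n.-tuple V) :
  C \in unitmx -> lincomb (invmx C) (lincomb C X) = X.
Proof. by move=> uC; apply: coord_mx_inj; rewrite !coord_mx_lincomb mulKmx. Qed.

Lemma span_lincomb m n (C : 'M_(m, n)) (X : n.-tuple V) :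
  (<<lincomb C X>> <= <<X>>)%VS.
Proof.
apply/span_subvP => _ /tnthP[i ->]; rewrite tnth_mktuple.
by apply: rpred_sum => l _; apply/rpredZ/memv_span/mem_tnth.
Qed.

Lemma basis_lincomb n (C : 'M_n) (X : n.-tuple V) (U : {vspace V}) :
  C \in unitmx -> basis_of U X -> basis_of U (lincomb C X).
Proof.
move=> uC UX; rewrite basisEdim size_tuple (size_basis UX) leqnn andbT.
by rewrite -(span_basis UX) -{1}(lincombK X uC) span_lincomb.
Qed.

Lemma basis_change n (X Y : n.-tuple V) (U : {vspace V}) :
  basis_of U X -> basis_of U Y -> exists2 C, C \in unitmx & Y = lincomb C X.
Proof.
move=> UX UY; pose C := \matrix_(i, l) coord X l (tnth Y i).
have defY : Y = lincomb C X.
  apply: eq_from_tnth => i; rewrite tnth_mktuple.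
  rewrite {1}(coord_basis UX (basis_mem UY (mem_tnth i Y))).
  by apply: eq_bigr => l _; rewrite mxE [tnth X l](tnth_nth 0).
exists C => //; rewrite -row_free_unit.
have := basis_free UY; rewrite free_coord_mx defY coord_mx_lincomb -!row_leq_rank.
by move=> le; apply: leq_trans le _; exact: mxrankM_maxl.
Qed.

End CoordMatrix.

(** * Minors and Cramer's rule *)

Lemma row_free_minor (K : fieldType) n N (B : 'M[K]_(n, N)) :
  row_free B -> exists I : 'I_n -> 'I_N, \det (colsub I B) != 0.
Proof.
move=> fB; have fBt : row_full B^T by rewrite /row_full mxrank_tr.
exists (fullrankfun fBt); rewrite -det_tr trmx_mxsub.
by have := fullrowsub_unit fBt; rewrite unitmxE unitfE.
Qed.

Lemma row_free_rowsub (K : fieldType) m n r (A : 'M[K]_(m, n)) :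
  \rank A = r -> exists f : 'I_r -> 'I_m, row_free (rowsub f A).
Proof. by move=> <-; exists (maxrankfun A); exact: maxrowsub_free. Qed.

Lemma det_colsub_row_free (K : fieldType) n N (B : 'M[K]_(n, N)) (I : 'I_n -> 'I_N) :
  \det (colsub I B) != 0 -> row_free B.
Proof.
rewrite -unitfE -unitmxE -row_free_unit => fI; apply: inj_row_free => v vB0.
apply: (row_free_inj fI); rewrite mul0mx; apply/matrixP => i k.
have /matrixP/(_ i (I k)) := vB0; rewrite [RHS]mxE => vBik; rewrite [RHS]mxE -vBik !mxE.
by apply: eq_bigr => j _; rewrite mxE.
Qed.

(** The cofactors along column [k] do not see that column, so the product is the expansion of the
    determinant in which column [k] has been replaced by column [j] of [B]. *)
Lemma adj_colsub_mul (K : fieldType) n N (B : 'M[K]_(n, N)) (I : 'I_n -> 'I_N) k j :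
  (\adj (colsub I B) *m B) k j = \det (colsub [eta I with k |-> j] B).
Proof.
rewrite mxE (expand_det_col _ k); apply: eq_bigr => l _.
rewrite mulrC !mxE /= eqxx; congr (_ * _); rewrite /cofactor; congr (_ * \det _).
by apply/matrixP => a b; rewrite !mxE /= eq_sym (negPf (neq_lift _ _)).
Qed.

Section Frames.
Variables (K : fieldType) (Q : quiver) (X : rep K Q) (e : vertex Q -> nat).
Local Notation Gr := (quiverGr X e).
Implicit Types (U : gr_point X e) (b : frames X e).

Lemma plueckerE v I b : pluecker I b = \det (colsub I (coord_mx (b v))).
Proof. by congr (\det _); apply/matrixP => j k; rewrite !mxE. Qed.

Lemma gr_point_eq U U' : (forall v, sval U v = sval U' v) -> U = U'.
Proof.
case: U U' => [U hU] [U' hU'] /= eqU.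
have UU' : U = U' by exact: functional_extensionality_dep.
by move: hU'; rewrite -UU' => hU'; congr exist; exact: Prop_irrelevance.
Qed.

Lemma hlift_exists U : exists b, @hlift _ Gr U b.
Proof.
have ex v : exists t : (e v).-tuple (X v), basis_of (sval U v) t.
  case: U => U [_ /= dimU]; rewrite -dimU; exists (vbasis (U v)); exact: vbasisP.
by exists (fun v => projT1 (cid (ex v))) => v; exact: projT2 (cid (ex v)).
Qed.

(** A change of basis by matrices [C v] multiplies a function of multidegree [n] by the product of
    the [\det (C v) ^+ n v]. A covering quiver may have infinitely many vertices, hence the finite
    list [s]; outside it the matrices are of size 0 and have determinant 1. *)
Lemma hhomog_quiverGr (s : seq (vertex Q)) :
  uniq s -> (forall v, v \notin s -> e v = 0%N) -> hhomog Gr.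
Proof.
move=> s_uniq s_e n f U b b' hf Ub Ub'.
have ex v := basis_change (Ub v) (Ub' v).
pose C v := projT1 (cid2 (ex v)).
have uC v : \det (C v) != 0.
  by rewrite -unitfE -unitmxE /C; case: (cid2 (ex v)).
have bC v : b' v = lincomb (C v) (b v) by rewrite /C; case: (cid2 (ex v)).
pose c m := \prod_(v <- s) \det (C v) ^+ m v.
have c_neq0 m : c m != 0.
  rewrite /c; elim/big_rec: _ => [|v x _ x0]; first exact: oner_neq0.
  by rewrite mulf_neq0 ?expf_neq0.
suff -> : f b' = c n * f b by move=> fb; rewrite mulf_neq0.
elim: hf => {n f} [a|_ _ [v I]|n f g _ -> _ ->|m n f g _ -> _ ->].
- by rewrite /c big1 ?mul1r // => v _; rewrite expr0.
- have -> : pluecker I b' = \det (C v) * pluecker I b.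
    rewrite !plueckerE bC coord_mx_lincomb -det_mulmx; congr (\det _).
    by apply/matrixP => i j; rewrite !mxE; apply: eq_bigr => l _; rewrite !mxE.
  congr (_ * _); case sv: (v \in s).
    rewrite /c (bigD1_seq v) //= eqxx expr1 big1 ?mulr1 // => w /negPf ->.
    by rewrite expr0.
  have ev := s_e v (negbT sv); rewrite /c big_seq big1 => [|w ws].
    by move: (C v); rewrite ev => D; rewrite det_mx00.
  by case: eqP ws => [->|_ _]; rewrite ?sv ?expr0.
- by rewrite mulrDr.
- rewrite mulrACA; congr (_ * _); rewrite /c -big_split /=.
  by apply: eq_bigr => v _; rewrite exprD.
Qed.

(** The vectors of [b v] are not functions of the Pluecker coordinates. Multiplying the frame by the
    adjugate of a minor that is nonzero at [b] makes its entries Pluecker coordinates, so they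
    acquire the multidegree of the vertex [v]. *)
Lemma local_frame U b v : @hlift _ Gr U b ->
  exists (g : frames X e -> K) (W : frames X e -> (e v).-tuple (X v)),
    [/\ @hpoly _ Gr (fun w => (w == v) : nat) g, g b != 0,
        forall U1 b1, @hlift _ Gr U1 b1 -> g b1 != 0 -> basis_of (sval U1 v) (W b1) &
        forall j, @hvec _ Gr _ (fun w => (w == v) : nat) (fun b => tnth (W b) j)].
Proof.
move=> Ub; have := basis_free (Ub v); rewrite free_coord_mx => /row_free_minor[I bI].
have hI J : @hpoly _ Gr (fun w => (w == v) : nat) (@pluecker _ _ X e v J).
  by apply: hpoly_coord; exact: PlueckerCoord.
exists (pluecker I), (fun b => lincomb (\adj (colsub I (coord_mx (b v)))) (b v)).
split=> // [|U1 b1 Ub1|j l]; first by rewrite plueckerE.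
  rewrite plueckerE => b1I; apply: basis_lincomb => //.
  (* The determinants of a matrix and its adjugate multiply to the [e v]-th power of the former, so
     a singular adjugate would make the minor vanish. *)
  rewrite unitmxE unitfE; apply: contraNneq b1I => adj0.
  have /(congr1 determinant) := mul_mx_adj (colsub I (coord_mx (b1 v))).
  rewrite det_mulmx adj0 mulr0 det_scalar => /esym/eqP; rewrite expf_eq0.
  by case/andP.
suff h : @hpoly _ Gr (fun w => (w == v) : nat) (fun b => \sum_(k < \dim {:X v})
    (l (vbasis {:X v})`_k : K) * pluecker [eta I with j |-> k] b).
  apply: hpoly_eq h _ _ => // b1; rewrite tnth_coord_mx linear_sum; apply: eq_bigr => k _.
  by rewrite coord_mx_lincomb adj_colsub_mul linearZ /= mulrC plueckerE.
by apply: hpoly_sum => [|k _]; [exact: hpoly_zero (hI I)|exact/hpoly_scale/hI].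
Qed.

Lemma local_frames (s : seq (vertex Q)) U b : @hlift _ Gr U b ->
  exists n (g : frames X e -> K) (W : frames X e -> frames X e),
    [/\ @hpoly _ Gr n g, g b != 0,
        forall U1 b1, @hlift _ Gr U1 b1 -> g b1 != 0 ->
          forall v, v \in s -> basis_of (sval U1 v) (W b1 v) &
        forall v j, @hvec _ Gr _ (fun w => (w == v) : nat) (fun b => tnth (W b v) j)].
Proof.
move=> Ub; have ex v := local_frame v Ub.
pose g v := projT1 (cid (ex v)); pose W v := projT1 (cid (projT2 (cid (ex v)))).
have gW v := projT2 (cid (projT2 (cid (ex v)))).
have hg v : @hpoly _ Gr (fun w => (w == v) : nat) (g v) by have [] := gW v.
exists (fun k => \sum_(v <- s) (k == v))%N, (fun b => \prod_(v <- s) g v b).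
exists (fun b v => W v b); split.
- exact: hpoly_prod.
- by rewrite prodf_seq_neq0; apply/allP => v _; have [] := gW v.
- move=> U1 b1 Ub1; rewrite prodf_seq_neq0 => /allP gs v vs.
  by have [_ _ + _] := gW v; apply=> //; exact: (gs v vs).
- by move=> v j; have [] := gW v.
Qed.

(** A Pluecker coordinate at [v] pulls back to minors whose multidegree is the sum of those of the
    frame vectors at [v]; [M] extends this additively. At vertices outside [s] the only minor is the
    empty one, the constant 1. *)
Lemma frames_pullback (S : hset K) (s : seq (vertex Q)) (tau : hrep S -> frames X e)
    (m : forall v, 'I_(e v) -> hfactor S -> nat) (P : gr_point X e -> Prop) :
  uniq s -> (forall v, v \notin s -> e v = 0%N) ->
  (forall v j, hvec (m v j) (fun r => tnth (tau r v) j)) ->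
  let M n k := (\sum_(v <- s) n v * \sum_j m v j k)%N in
  @graded_pullback _ S Gr M tau /\ @graded_pullback _ S (@sublocus _ Gr P) M tau.
Proof.
move=> s_uniq s_e htau M.
have M0 : M (fun=> 0%N) = fun=> 0%N by apply: funext => k; apply: big1.
have MD m1 m2 : M (fun k => m1 k + m2 k)%N = fun k => (M m1 k + M m2 k)%N.
  apply: funext => k; rewrite /M -big_split; apply: eq_bigr => v _.
  exact: mulnDl.
suff Mc n f : @hcoord _ Gr n f -> hpoly (M n) (fun r => f (tau r)) by [].
case=> v I.
have h : hpoly (fun k => \sum_j m v j k)%N (fun r => pluecker I (tau r)).
  apply: hpoly_det => j k.
  by apply: hpoly_eq (hvec_coord (vbasis {:X v}) (I k) (htau v j)) _ _ => // r; rewrite mxE.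
case sv: (v \in s).
  apply: hpoly_eq h _ _ => // k.
  rewrite /M (bigD1_seq v) //= eqxx mul1n [X in (_ + X)%N]big1 ?addn0 // => w /negPf ->.
  by rewrite mul0n.
have ev := s_e v (negbT sv).
apply: hpoly_eq (hpoly_const S 1) _ _ => [k|r].
  rewrite /M big_seq big1 // => w ws.
  by case: eqP ws => [->|_ _]; rewrite ?sv ?mul0n.
rewrite /pluecker; move: (\matrix_(_, _) _); rewrite ev => D.
by rewrite det_mx00.
Qed.

End Frames.

(** * Separating weights *)

(** A nonzero [p] has fewer than [size p] roots, so it cannot vanish at the first [size p] natural
    numbers. *)
Lemma int_poly_nonroot (p : {poly int}) : p != 0 -> exists N : int, p.[N] != 0.
Proof.
move=> p0; apply: contrapT => pN.
pose rs : seq int := [seq i%:Z | i <- iota 0 (size p)].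
have := @max_poly_roots _ p rs p0; rewrite size_map size_iota ltnn => h.
suff : false by []; apply: h.
  apply/allP => x _; apply: contrapT => /negP px; apply: pN.
  by exists x; move: px; rewrite rootE.
by rewrite map_inj_uniq ?iota_uniq // => i j [].
Qed.

(* A linear form injective on a finite set of characters is found among
   [chi |-> \sum_i chi_i N^i]: finitely many polynomials in [N] have to be
   nonzero. A constant shift makes the values nonnegative. *)
Lemma separating_weight (I : finType) (A : {fset {ffun I -> int}}) :
  exists (w : {ffun I -> int} -> int) (d : {ffun I -> int} -> nat) (k : int),
    [/\ {morph w : x y / x + y}, {in A &, injective d} &
        {in A, forall c, (d c)%:Z = w c + k}].
Proof.
pose P (c : {ffun I -> int}) : {poly int} := \sum_i (c i) *: 'X^(enum_rank i).
have PB : {morph P : x y / x - y}.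
  move=> x y; rewrite /P -sumrB; apply: eq_bigr => i _.
  by rewrite !ffunE scalerBl.
have PD : {morph P : x y / x + y}.
  move=> x y; rewrite /P -big_split; apply: eq_bigr => i _.
  by rewrite !ffunE scalerDl.
have P0 c : P c = 0 -> c = 0.
  move=> Pc; apply/ffunP => i; rewrite ffunE.
  have := congr1 (fun p : {poly int} => p`_(enum_rank i)) Pc; rewrite /= coef0 => <-.
  rewrite coef_sum (bigD1 i) //= coefZ coefXn eqxx mulr1 big1 ?addr0 // => j ji.
  rewrite coefZ coefXn; case: eqP => [/val_inj/enum_rank_inj eij|_]; last by rewrite mulr0.
  by rewrite eij eqxx in ji.
(* If this product is nonzero at [N], evaluation at [N] separates every pair of distinct characters
   in [A]. *)
have [N hN] : exists N : int,
    (\prod_(x : A) \prod_(y : A | x != y) P (val x - val y)).[N] != 0.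
  apply: int_poly_nonroot; apply/prodf_neq0 => x _; apply/prodf_neq0 => y xy.
  by apply: contraNneq xy => /P0/eqP; rewrite subr_eq0 => /eqP/val_inj->.
have wI : {in A &, injective (fun c => (P c).[N])}.
  move=> x y xA yA /eqP; rewrite -subr_eq0 -hornerN -hornerD -PB => /eqP exy.
  apply/eqP; apply: contraNT hN => nxy; apply/eqP.
  rewrite (bigD1 [` xA]%fset) //= (bigD1 [` yA]%fset) /=; last by rewrite -val_eqE.
  by rewrite !hornerM exy !mul0r.
(* The shift dominates every absolute value. Nonnegative weights matter because [t], and not its
   inverse, is a coordinate on the torus. *)
pose k : int := \sum_(c : A) `|(P (val c)).[N]|.
have wk c : c \in A -> 0 <= (P c).[N] + k.
  move=> cA; rewrite /k (bigD1 [` cA]%fset) //= addrA addr_ge0 ?sumr_ge0 //.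
  by rewrite -lerBlDl sub0r -normrN ler_norm.
exists (fun c => (P c).[N]), (fun c => `|((P c).[N] + k)%R|%N), k; split.
- by move=> x y /=; rewrite PD hornerD.
- move=> x y xA yA /= /(congr1 Posz); rewrite !gez0_abs ?wk // => /addIr.
  exact: wI.
- by move=> c cA; rewrite gez0_abs ?wk.
Qed.

(** * Push-down of representations *)

Section DirectSumTheory.
Variables (K : fieldType) (T : choiceType) (s : {fset T}) (V : T -> vectType K).

Lemma dsum_in_eq (c : s) (u : V (val c)) : @dsum_in K T s V (val c) u c = u.
Proof. by rewrite ffunE; case: eqP => // p; rewrite (eq_irrelevance p erefl). Qed.

Lemma dsum_in_neq (c : s) x (u : V x) :
  x != val c -> @dsum_in K T s V x u c = 0.
Proof. by rewrite ffunE; case: eqP. Qed.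

End DirectSumTheory.

Section PushDownTheory.
Variables (K : fieldType) (Q : finQuiver) (X : fdrep K (coverQuiver Q)).
Implicit Types (i : fvertex Q) (c : charGroup Q) (a : farrow Q).

Definition push_proj i (c : supp_fiber X i) : 'Hom(push X i, X (i, val c)) :=
  linfun (@dsum_proj K _ (supp_fiber X i) (fun c => X (i, c)) c).

(** Unlike [push_proj], this takes an arbitrary character, so that [c + char_gen a] needs no proof
    of membership in the support. *)
Definition push_in i c : 'Hom(X (i, c), push X i) :=
  linfun (@dsum_in K _ (supp_fiber X i) (fun c => X (i, c)) c).

Lemma push_projE i (c : supp_fiber X i) f :
  push_proj c f = (f : dsum (supp_fiber X i) (fun c => X (i, c))) c.
Proof. by rewrite /push_proj lfunE. Qed.

Lemma push_inE i c u : push_in i c u = dsum_in (supp_fiber X i) u.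
Proof. exact: (lfunE (@dsum_in K _ (supp_fiber X i) (fun c => X (i, c)) c)). Qed.

Lemma mem_supp_fiber i c : (c \in supp_fiber X i) = ((i, c) \in supp X).
Proof.
apply/idP/idP => [ci|ic]; first exact: (supp_fiberP [` ci]%fset).
by apply/imfsetP; exists (i, c); rewrite //= inE /= ic eqxx.
Qed.

Lemma notin_supp v (u : X v) : v \notin supp X -> u = 0.
Proof.
rewrite suppP negbK dimv_eq0 => /eqP V0.
by apply/eqP; rewrite -memv0 -V0 memvf.
Qed.

Lemma push_projK i (c : supp_fiber X i) u : push_proj c (push_in i (val c) u) = u.
Proof. by rewrite push_projE push_inE; exact: dsum_in_eq. Qed.

Lemma push_proj_in_neq i (c : supp_fiber X i) c' u :
  c' != val c -> push_proj c (push_in i c' u) = 0.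
Proof. by move=> cc'; rewrite push_projE push_inE; exact: dsum_in_neq. Qed.

Lemma push_ext i (f f' : push X i) :
  (forall c : supp_fiber X i, push_proj c f = push_proj c f') -> f = f'.
Proof. by move=> ff'; apply/ffunP => c; have := ff' c; rewrite !push_projE. Qed.

Lemma push_proj_sum_in i (c : supp_fiber X i)
    (u : forall c : supp_fiber X i, X (i, val c)) :
  push_proj c (\sum_x push_in i (val x) (u x)) = u c.
Proof.
rewrite linear_sum (bigD1 c) //= push_projK big1 ?addr0 // => c' cc'.
by rewrite push_proj_in_neq.
Qed.

Lemma push_sum i (f : push X i) : f = \sum_x push_in i (val x) (push_proj x f).
Proof.
by apply: push_ext => c; rewrite (push_proj_sum_in c (fun x => push_proj x f)).
Qed.

Lemma push_mapE a (f : push X (fsrc a)) :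
  @rmap _ _ (push X) a f = \sum_(c : supp_fiber X (fsrc a))
    push_in (ftgt a) (val c + char_gen a)
      (@rmap K (coverQuiver Q) X (a, val c) (push_proj c f)).
Proof. by rewrite sum_lfunE; apply: eq_bigr => c _; rewrite !comp_lfunE. Qed.

Lemma push_map_in a c (u : X (fsrc a, c)) :
  @rmap _ _ (push X) a (push_in (fsrc a) c u) =
  push_in (ftgt a) (c + char_gen a) (@rmap K (coverQuiver Q) X (a, c) u).
Proof.
have [ci|ci] := boolP (c \in supp_fiber X (fsrc a)); last first.
  by rewrite mem_supp_fiber in ci; rewrite (notin_supp u ci) !linear0.
rewrite push_mapE (bigD1 [` ci]%fset) //= big1 ?addr0 => [|c' cc'].
  by have /= -> := push_projK (c := [` ci]%fset) u.
by rewrite push_proj_in_neq ?linear0 // eq_sym; move: cc'; rewrite -val_eqE.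
Qed.

Section Weights.
Variable d : charGroup Q -> nat.

Definition push_weight (v : supp X) : int := (d (val v).2)%:Z.
Local Notation wact := (weight_act push_weight).

Lemma push_proj_wact t i (f : push X i) (c : supp_fiber X i) :
  push_proj c (wact t i f) = t ^+ d (val c) *: push_proj c f.
Proof. by rewrite !push_projE /weight_act lfunE /= ffunE. Qed.

Lemma wact_in t i c (u : X (i, c)) :
  wact t i (push_in i c u) = t ^+ d c *: push_in i c u.
Proof.
apply: push_ext => c'; rewrite push_proj_wact linearZ /=.
have [e|cc'] := eqVneq c (val c'); first by congr (t ^+ d _ *: _); rewrite e.
by rewrite push_proj_in_neq // !scaler0.
Qed.

Lemma wact_sum t i (f : push X i) :
  wact t i f = \sum_x t ^+ d (val x) *: push_in i (val x) (push_proj x f).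
Proof.
by rewrite {1}(push_sum f) linear_sum; apply: eq_bigr => c _ /=; rewrite wact_in.
Qed.

Lemma wact1 i (f : push X i) : wact 1 i f = f.
Proof. by apply: push_ext => c; rewrite push_proj_wact expr1n scale1r. Qed.

Lemma wactM t u i (f : push X i) : wact (t * u) i f = wact t i (wact u i f).
Proof. by apply: push_ext => c; rewrite !push_proj_wact exprMn scalerA. Qed.

Lemma lker_wact t i : t != 0 -> lker (wact t i) == 0%VS.
Proof.
move=> t0; apply/lker0P => f f' ff'; apply: push_ext => c.
have := congr1 (push_proj c) ff'; rewrite !push_proj_wact.
by apply: scalerI; rewrite expf_neq0.
Qed.

(** The arrow [a] raises all weights by the same amount [w a], so it commutes with the torus up to a
    scalar, which no subspace notices. *)
Lemma push_map_wact (w : farrow Q -> int) t a (f : push X (fsrc a)) :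
  (forall c, (fsrc a, c) \in supp X -> (ftgt a, c + char_gen a) \in supp X ->
     (d (c + char_gen a))%:Z = (d c)%:Z + w a) ->
  t != 0 ->
  @rmap _ _ (push X) a (wact t (fsrc a) f) =
  t ^ (- w a) *: wact t (ftgt a) (@rmap _ _ (push X) a f).
Proof.
move=> dw t0; rewrite wact_sum linear_sum push_mapE linear_sum scaler_sumr.
apply: eq_bigr => c _; rewrite linearZ /= push_map_in wact_in scalerA.
(* Off the support [dw] gives no information, but there the target space is zero. *)
have [cX|cX] := boolP ((ftgt a, val c + char_gen a) \in supp X); last first.
  by rewrite [rmap _ _ _](notin_supp _ cX) linear0 !scaler0.
congr (_ *: _); have := dw (val c); rewrite -mem_supp_fiber => /(_ (valP c) cX) dc.
by rewrite !exprnP dc -expfzDr // addrCA addNr addr0.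
Qed.

End Weights.
End PushDownTheory.

(** * Graded subrepresentations *)

Section Graded.
Variables (K : fieldType) (Q : finQuiver) (X : fdrep K (coverQuiver Q)).
Implicit Types (i : fvertex Q) (a : farrow Q).
Implicit Types (U : forall i : vertex Q, {vspace push X i}).
Implicit Types (Z : forall v : vertex (coverQuiver Q), {vspace X v}).

(** Taking the preimage under the inclusion, not the image under the projection, yields a
    subrepresentation even when [U] is not graded. *)
Definition component U (v : vertex (coverQuiver Q)) : {vspace X v} :=
  let: (i, c) as v0 := v return {vspace X v0} in (push_in X i c @^-1: U i)%VS.

(** This is the direct sum of the [Z (i, c)], described by its projections. *)
Definition glue Z i : {vspace push X i} :=
  (\bigcap_(c : supp_fiber X i) (push_proj c @^-1: Z (i, val c)))%VS.

Definition graded U : Prop := forall i (c : supp_fiber X i) f,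
  f \in U i -> push_in X i (val c) (push_proj c f) \in U i.

Lemma mem_component U i c (u : X (i, c)) :
  (u \in component U (i, c)) = (push_in X i c u \in U i).
Proof. by rewrite /= -memv_preim. Qed.

Lemma mem_glue Z i f :
  f \in glue Z i <-> forall c : supp_fiber X i, push_proj c f \in Z (i, val c).
Proof.
rewrite memvE; split=> [/subv_bigcapP h c|h].
  by rewrite memv_preim memvE h.
by apply/subv_bigcapP => c _; rewrite -memvE -memv_preim.
Qed.

Lemma vspace_notin_supp v (A B : {vspace X v}) : v \notin supp X -> A = B.
Proof. by move=> vX; apply/vspaceP => u; rewrite (notin_supp u vX) !mem0v. Qed.

Lemma mem_glue_in Z i c (u : X (i, c)) :
  u \in Z (i, c) -> push_in X i c u \in glue Z i.
Proof.
move=> uU; apply/mem_glue => c'; have [e|cc'] := eqVneq c (val c').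
  by subst c; rewrite push_projK.
by rewrite push_proj_in_neq ?mem0v.
Qed.

Lemma componentK U : graded U -> forall i, glue (component U) i = U i.
Proof.
move=> gU i; apply/vspaceP => f; apply/idP/idP => [/mem_glue h|fU]; last first.
  by apply/mem_glue => c; rewrite mem_component gU.
rewrite (push_sum f); apply: rpred_sum => c _.
by have := h c; rewrite mem_component.
Qed.

Lemma glueK Z v : component (glue Z) v = Z v.
Proof.
have [vX|vX] := boolP (v \in supp X); last exact: vspace_notin_supp.
case: v vX => i c ic; have ci : c \in supp_fiber X i by rewrite mem_supp_fiber.
apply/vspaceP => u; rewrite mem_component; apply/idP/idP => [/mem_glue|]; last first.
  exact: mem_glue_in.
by move=> /(_ [` ci]%fset) /=; have /= -> := push_projK (c := [` ci]%fset) u.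
Qed.

Lemma component_subrep U :
  @subrep _ _ (push X) U -> @subrep _ _ X (component U).
Proof.
move=> sU [a c]; apply/subvP => _ /memv_imgP[u uU ->].
rewrite mem_component in uU; rewrite mem_component -push_map_in.
by apply: (subvP (sU a)); exact: memv_img.
Qed.

Lemma glue_subrep Z : @subrep _ _ X Z -> @subrep _ _ (push X) (glue Z).
Proof.
move=> sU a; apply/subvP => _ /memv_imgP[f /mem_glue fU ->].
rewrite push_mapE; apply: rpred_sum => c _; apply: mem_glue_in.
by apply: (subvP (sU (a, val c))); exact: memv_img (fU c).
Qed.

Section GlueFrame.
Variables (n : vertex (coverQuiver Q) -> nat) (i : fvertex Q) (N : nat).
Hypothesis nN : (\sum_(c : supp_fiber X i) n (i, val c))%N = N.

Definition glue_idx : finType := {c : supp_fiber X i & 'I_(n (i, val c))}.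

Fact card_glue_idx : N = #|{: glue_idx}|.
Proof.
rewrite card_tagged -nN sumnE big_map big_enum /=.
by apply: eq_bigr => c _; rewrite card_ord.
Qed.

Definition glue_ord (k : 'I_N) : glue_idx := enum_val (cast_ord card_glue_idx k).

(** The concatenation of the frames [b (i, c)]. Its length is a variable [N] because it will be
    [e i], which equals the sum of the graded dimensions only propositionally. *)
Definition glue_frame (b : forall v, (n v).-tuple (X v)) : N.-tuple (push X i) :=
  [tuple push_in X i (val (tag (glue_ord k)))
     (tnth (b (i, val (tag (glue_ord k)))) (tagged (glue_ord k))) | k < N].

Lemma glue_ord_sum (G : zmodType) (F : glue_idx -> G) :
  \sum_k F (glue_ord k) = \sum_(c : supp_fiber X i)
    \sum_(j < n (i, val c)) F (Tagged (fun c : supp_fiber X i => 'I_(n (i, val c))) j).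
Proof.
rewrite sig_big_dep /=; pose h (x : glue_idx) := cast_ord (esym card_glue_idx) (enum_rank x).
rewrite (reindex h) /=; last first.
  exists glue_ord => [x _|k _]; first by rewrite /glue_ord cast_ordKV enum_rankK.
  by rewrite /h /glue_ord enum_valK cast_ordK.
apply: eq_bigr => x _; rewrite /glue_ord /h cast_ordKV enum_rankK.
by case: x.
Qed.

(** Projecting a linear relation to one summand leaves a relation among the vectors of a single
    [b (i, c)], which are free. *)
Lemma glue_frame_basis Z (b : forall v, (n v).-tuple (X v)) :
  (forall c : supp_fiber X i, basis_of (Z (i, val c)) (b (i, val c))) ->
  basis_of (glue Z i) (glue_frame b).
Proof.
move=> bU; rewrite /basis_of; apply/andP; split.
  rewrite eqEsubv; apply/andP; split.
    apply/span_subvP => _ /tnthP[k ->]; rewrite tnth_mktuple; apply: mem_glue_in.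
    exact: basis_mem (bU _) (mem_tnth _ _).
  apply/subvP => f /mem_glue fU; rewrite (push_sum f); apply: rpred_sum => c _.
  rewrite (coord_basis (bU c) (fU c)) linear_sum; apply: rpred_sum => j _.
  rewrite linearZ /=; apply/rpredZ/memv_span.
  pose x : glue_idx := Tagged (fun c : supp_fiber X i => 'I_(n (i, val c))) j.
  have := mem_tnth (cast_ord (esym card_glue_idx) (enum_rank x)) (glue_frame b).
  by rewrite tnth_mktuple /glue_ord cast_ordKV enum_rankK /= (tnth_nth 0).
apply/freeP => k k0.
pose k' (x : glue_idx) := k (cast_ord (esym card_glue_idx) (enum_rank x)).
have kE j : k j = k' (glue_ord j) by rewrite /k' /glue_ord enum_valK cast_ordK.
have {}k0 : \sum_(c : supp_fiber X i) push_in X i (val c) (\sum_(j < n (i, val c))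
    k' (Tagged (fun c : supp_fiber X i => 'I_(n (i, val c))) j) *: tnth (b (i, val c)) j) = 0.
  pose F (x : glue_idx) :=
    k' x *: push_in X i (val (tag x)) (tnth (b (i, val (tag x))) (tagged x)).
  rewrite -[RHS]k0; transitivity (\sum_j F (glue_ord j)).
    rewrite glue_ord_sum; apply: eq_bigr => c _; rewrite linear_sum.
    by apply: eq_bigr => j _; rewrite linearZ.
  by apply: eq_bigr => j _; rewrite -tnth_nth tnth_mktuple kE.
move=> j; rewrite kE; case: (glue_ord j) => c l {j}.
have := congr1 (push_proj c) k0; rewrite push_proj_sum_in linear0 => h.
have /freeP := basis_free (bU c).
move=> /(_ (fun l => k' (Tagged (fun c : supp_fiber X i => 'I_(n (i, val c))) l))).
by apply; rewrite -[RHS]h; apply: eq_bigr => j _; rewrite -tnth_nth.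
Qed.

End GlueFrame.

Lemma dim_glue Z i :
  \dim (glue Z i) = (\sum_(c : supp_fiber X i) \dim (Z (i, val c)))%N.
Proof.
have := @glue_frame_basis (fun v => \dim (Z v)) i _ erefl Z (fun v => vbasis (Z v)).
by move=> /(_ (fun c => vbasisP _)) /size_basis.
Qed.

(** With this description, a frame of [U i] projects to a spanning family of the component. *)
Lemma graded_component_img U i c (ci : c \in supp_fiber X i) : graded U ->
  (push_proj [` ci]%fset @: U i)%VS = component U (i, c).
Proof.
move=> gU; apply/vspaceP => u; rewrite mem_component.
apply/idP/idP => [/memv_imgP[f fU ->]|uU]; first exact: (gU i [` ci]%fset).
by have /= <- := push_projK (c := [` ci]%fset) u; exact: memv_img.
Qed.

Lemma sum_finsupp_fiber (e' : {fsfun vertex (coverQuiver Q) -> nat with 0%N}) i :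
  (forall v, v \notin supp X -> e' v = 0%N) ->
  (\sum_(v <- finsupp e' | v.1 == i) e' v)%N =
  (\sum_(c : supp_fiber X i) e' (i, val c))%N.
Proof.
move=> e'0; have sub : (finsupp e' `<=` supp X)%fset.
  apply/fsubsetP => v; rewrite mem_finsupp; apply: contraNT => /e'0 ->.
  by rewrite eqxx.
rewrite big_mkcond (big_fset_incl _ sub) /=; last first.
  by move=> v _; rewrite memNfinsupp => /eqP ->; rewrite if_same.
rewrite -big_mkcond -big_filter -(big_seq_fsetE _ _ predT (fun c => e' (i, c))) /=.
rewrite -(big_map (pair i) predT (fun v => e' v)); apply: perm_big.
apply: uniq_perm; first by rewrite filter_uniq ?fset_uniq.
  by rewrite map_inj_uniq ?fset_uniq // => c c' [].
move=> [j c]; rewrite mem_filter /=; apply/andP/mapP => [[/eqP -> jc]|[c' + [-> ->]]].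
  by exists c; rewrite ?mem_supp_fiber.
by rewrite mem_supp_fiber eqxx.
Qed.

End Graded.

(** The element [t = 2] acts on the summands by the scalars [2 ^+ d c], distinct in characteristic
    0. The projections to the summands are then polynomials in this operator, by Lagrange
    interpolation. *)
Lemma fixed_graded (K : numFieldType) (Q : finQuiver) (X : fdrep K (coverQuiver Q))
    (d : charGroup Q -> nat) (U : forall i : vertex Q, {vspace push X i}) :
  (forall i, {in supp_fiber X i &, injective d}) ->
  (forall t i, t != 0 -> (weight_act (push_weight (X := X) d) t i @: U i)%VS = U i) ->
  graded U.
Proof.
move=> dI fixU i c f fU.
pose l (c : supp_fiber X i) : K := 2%:R ^+ d (val c).
have lI c1 c2 : l c1 = l c2 -> c1 = c2.
  rewrite /l -!natrX => /eqP; rewrite eqr_nat => /eqP /(expnI (ltnSn 1)) dc.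
  by apply: val_inj; apply: dI dc; exact: valP.
(* Here [g] is [p] evaluated at the operator of [t = 2] and applied to [f]. *)
have stable (p : {poly K}) : exists2 g, g \in U i &
    forall c, push_proj c g = p.[l c] *: push_proj c f.
  elim/poly_ind: p => [|p a [g gU gE]].
    by exists 0; rewrite ?mem0v // => c1; rewrite linear0 horner0 scale0r.
  exists (weight_act (push_weight (X := X) d) 2%:R i g + a *: f).
    apply: rpredD; last exact: rpredZ.
    by rewrite -(fixU 2%:R i) ?pnatr_eq0 // memv_img.
  move=> c1; rewrite linearD linearZ /= push_proj_wact gE !hornerE scalerDl scalerA.
  by rewrite mulrC.
(* The unnormalized Lagrange polynomial: it kills all summands but the one of [c], where its value
   is [x] below. *)
have [g gU gE] := stable (\prod_(c1 : supp_fiber X i | c1 != c) ('X - (l c1)%:P)).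
pose x := \prod_(c1 : supp_fiber X i | c1 != c) (l c - l c1).
have x0 : x != 0.
  by apply/prodf_neq0 => c1; apply: contraNneq => /subr0_eq /lI ->.
suff -> : push_in X i (val c) (push_proj c f) = x^-1 *: g by exact: rpredZ.
apply: push_ext => c1; rewrite linearZ /= gE horner_prod scalerA.
have [->|c1c] := eqVneq c1 c.
  rewrite push_projK; under eq_bigr do rewrite hornerXsubC.
  by rewrite mulVf ?scale1r.
rewrite push_proj_in_neq; last by rewrite eq_sym.
by rewrite (bigD1 c1) //= hornerXsubC subrr mul0r mulr0 scale0r.
Qed.

(** * The action on the quiver Grassmannian *)

Definition vertices (Q : finQuiver) : seq (vertex Q) := enum (fvertex Q).

Lemma vertices_uniq (Q : finQuiver) : uniq (vertices Q).
Proof. exact: enum_uniq. Qed.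

Lemma mem_vertices (Q : finQuiver) (i : vertex Q) : i \in vertices Q.
Proof. by rewrite mem_enum. Qed.

Section Action.
Variables (K : fieldType) (Q : finQuiver) (X : fdrep K (coverQuiver Q)).
Variables (d : charGroup Q -> nat) (w : farrow Q -> int) (e : vertex Q -> nat).
Hypothesis dw : forall a c,
  (fsrc a, c) \in supp X -> (ftgt a, c + char_gen a) \in supp X ->
  (d (c + char_gen a))%:Z = (d c)%:Z + w a.
Local Notation wact := (weight_act (push_weight (X := X) d)).
Local Notation Gr := (quiverGr (push X) e).

Fact gm_act_proof (t : Gm K) (U : gr_point (push X) e) :
  @subrep _ _ (push X) (fun i => wact (sval t) i @: sval U i)%VS /\
  forall i, \dim (wact (sval t) i @: sval U i) = e i.
Proof.
case: t U => t t0 [U [sU dimU]] /=; split=> [a|i].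
  apply/subvP => _ /memv_imgP[_ /memv_imgP[f fU ->] ->].
  rewrite (push_map_wact _ (@dw a)) //; apply: rpredZ; apply: memv_img.
  by apply: (subvP (sU a)); exact: memv_img.
by rewrite -(dimU i); apply: limg_dim_eq; rewrite (eqP (lker_wact _ _ _ t0)) capv0.
Qed.

Definition gm_act (t : Gm K) (U : gr_point (push X) e) : gr_point (push X) e :=
  exist _ _ (gm_act_proof t U).

Lemma hhomog_push : hhomog Gr.
Proof.
refine (@hhomog_quiverGr K Q (push X) e (vertices Q) _ _); first exact: vertices_uniq.
by move=> v; rewrite mem_vertices.
Qed.

Lemma hpoly_Gm_exp n : @hpoly K (Gm_prod Gr) (fun=> 0%N) (fun tr => sval tr.1 ^+ n).
Proof.
elim: n => [|n IHn]; first exact: hpoly_const.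
have ht : @hpoly K (Gm_prod Gr) (fun=> 0%N) (fun tr => sval tr.1).
  by apply: hpoly_coord; exact: Gm_prod_coord_fst.
by apply: hpoly_eq (hpoly_mul ht IHn) _ _ => // tr; rewrite exprS.
Qed.

(** Each graded part is multiplied by a power of [t], which has multidegree 0. *)
Lemma hvec_wact i m (F : frames (push X) e -> push X i) :
  @hvec _ Gr _ m F ->
  @hvec _ (Gm_prod Gr) _ m (fun tr => wact (sval tr.1) i (F tr.2)).
Proof.
move=> hF l.
have hl (c : supp_fiber X i) := hpoly_mul (hpoly_Gm_exp (d (val c)))
  (hpoly_Gm_prod (hF (l \o push_in X i (val c) \o push_proj c)%VF)).
have h0 := hpoly_zero (hpoly_Gm_prod (hF 0)).
have h := hpoly_sum (index_enum _) h0 (fun c (_ : predT c) => hl c).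
apply: hpoly_eq h _ _ => // tr; rewrite wact_sum linear_sum.
by apply: eq_bigr => c _; rewrite linearZ /= !comp_lfunE.
Qed.

(** For the morphism property, [tau] lets [t] act on a local multihomogeneous frame of [U], giving a
    frame of [t.U]; [iota] is the identity. *)
Lemma gm_act_algebraic : algebraic_Gm_action (S := Gr) gm_act.
Proof.
split=> [U|t u U|].
- apply: gr_point_eq => i /=; apply/vspaceP => f.
  apply/idP/idP => [/memv_imgP[g gU ->]|fU]; first by rewrite wact1.
  by rewrite -(wact1 d f) memv_img.
- apply: gr_point_eq => i /=; rewrite -limg_comp; congr (_ @: _)%VS.
  by apply/lfunP => f; rewrite comp_lfunE wactM.
apply: local_morphism => -[t0 U0].
have [b0 Ub0] := hlift_exists U0.
have [n [g [W [hg g0 gW hW]]]] := local_frames (vertices Q) Ub0.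
pose tau (tr : Gm K * frames (push X) e) : frames (push X) e :=
  fun i => [tuple of map (wact (sval tr.1) i) (W tr.2 i)].
exists Gr, id, (fun tr => g tr.2), tau.
have [|||hM _] := @frames_pullback _ _ _ _ (Gm_prod Gr) (vertices Q) tau
  (fun v j w => (w == v) : nat) (fun=> True).
- exact: vertices_uniq.
- by move=> v; rewrite mem_vertices.
- move=> i j; have h := hvec_wact (hW i j); move=> l.
  by apply: hpoly_eq (h l) _ _ => // tr; rewrite tnth_map.
eexists; split; [exact: hhomog_push|by split|exact: hM| |].
- split; first by exists n; exact: hpoly_Gm_prod.
    by exists (t0, b0).
  by move=> [t U] [t1 b1] [t2 b2] [_ /= Ub1] [_ /= Ub2]; exact: hhomog_push hg Ub1 Ub2.
- move=> [t U] [t1 b1] [/= <- Ub1] gb1; exists (gm_act t U) => // i /=.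
  apply: limg_basis_of; last by apply: gW => //; rewrite mem_vertices.
  by rewrite (eqP (lker_wact _ _ _ (svalP t))) capv0.
Qed.

End Action.

(** * The fixed locus *)

Lemma tuple_size0_free (K : fieldType) (V : vectType K) n (t : n.-tuple V)
    (A : {vspace V}) : n = 0%N -> free t /\ {subset t <= A}.
Proof. by move=> n0; subst n; rewrite (tuple0 t); split=> //; exact: nil_free. Qed.

Section FixedLocus.
Variables (K : numFieldType) (Q : finQuiver) (X : fdrep K (coverQuiver Q)).
Variables (d : charGroup Q -> nat) (w : farrow Q -> int) (e : vertex Q -> nat).
Hypothesis dI : forall i, {in supp_fiber X i &, injective d}.
Hypothesis dw : forall a c,
  (fsrc a, c) \in supp X -> (ftgt a, c + char_gen a) \in supp X ->
  (d (c + char_gen a))%:Z = (d c)%:Z + w a.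
Local Notation Gr := (quiverGr (push X) e).
Local Notation act := (@gm_act K Q X d w e dw).
Local Notation fixed := (fun U : hpoint Gr => forall t, act t U = U).
Local Notation cover_dim := {e' : {fsfun vertex (coverQuiver Q) -> nat with 0%N}
                                | compatible e e'}.
Local Notation Union := (disjoint_union
  (fun e' : cover_dim => variety (quiverGr X (sval e')))).

Lemma fixed_point_graded (U : hpoint Gr) : fixed U -> graded (sval U).
Proof.
move=> fixU; apply: (fixed_graded dI) => t i t0.
by rewrite -[in RHS](fixU (exist _ t t0)).
Qed.

Lemma sum_dim_component (U : hpoint Gr) i : fixed U ->
  (\sum_(c : supp_fiber X i) \dim (component (sval U) (i, val c)))%N = e i.
Proof.
move=> fixU; rewrite -dim_glue componentK; last exact: fixed_point_graded.
by have [_] := svalP U.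
Qed.

Definition component_dim (U : hpoint Gr) :
    {fsfun vertex (coverQuiver Q) -> nat with 0%N} :=
  [fsfun v in supp X => \dim (component (sval U) v) | 0%N]%fset.

Lemma component_dimE U v : component_dim U v = \dim (component (sval U) v).
Proof.
rewrite fsfunE; case: ifP => // /negbT vX.
by apply/esym/eqP; rewrite dimv_eq0; apply/eqP; exact: vspace_notin_supp.
Qed.

Lemma component_dim_supp U v : v \notin supp X -> component_dim U v = 0%N.
Proof. by rewrite fsfunE => /negPf ->. Qed.

Lemma component_dim_compatible U : fixed U -> compatible e (component_dim U).
Proof.
move=> fixU i; rewrite (sum_finsupp_fiber (X := X)); last exact: component_dim_supp.
rewrite -(sum_dim_component i fixU).
by apply: eq_bigr => c _; rewrite component_dimE.
Qed.

Fact component_point_proof (U : hpoint Gr) :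
  @subrep _ _ X (component (sval U)) /\
  forall v, \dim (component (sval U) v) = component_dim U v.
Proof.
split=> [|v]; last by rewrite component_dimE.
by apply: component_subrep; have [] := svalP U.
Qed.

Definition to_cover (x : fixed_locus (S := Gr) act) : Union :=
  existT _ (exist _ (component_dim (sval x)) (component_dim_compatible (svalP x)))
    (exist _ _ (component_point_proof (sval x))).

Lemma cover_dim_supp (e' : cover_dim) (Y : gr_point X (sval e')) v :
  v \notin supp X -> sval e' v = 0%N.
Proof.
move=> vX; have [_ <-] := svalP Y.
by apply/eqP; rewrite dimv_eq0; apply/eqP; exact: vspace_notin_supp.
Qed.

Lemma cover_dim_sum (e' : cover_dim) (Y : gr_point X (sval e')) i :
  (\sum_(c : supp_fiber X i) sval e' (i, val c))%N = e i.
Proof.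
rewrite -(svalP e' i) (sum_finsupp_fiber (X := X)) // => v.
exact: cover_dim_supp Y v.
Qed.

Fact glue_point_proof (e' : cover_dim) (Y : gr_point X (sval e')) :
  @subrep _ _ (push X) (glue (sval Y)) /\ forall i, \dim (glue (sval Y) i) = e i.
Proof.
split=> [|i]; first by apply: glue_subrep; have [] := svalP Y.
rewrite dim_glue -(cover_dim_sum Y i); apply: eq_bigr => c _.
by have [_] := svalP Y.
Qed.

Definition glue_point (e' : cover_dim) (Y : gr_point X (sval e')) : hpoint Gr :=
  exist _ _ (glue_point_proof Y).

Fact glue_point_fixed (e' : cover_dim) (Y : gr_point X (sval e')) :
  fixed (glue_point Y).
Proof.
move=> t; apply: gr_point_eq => i /=; apply/eqP.
rewrite eqEdim; apply/andP; split.
  apply/subvP => _ /memv_imgP[f /mem_glue fU ->]; apply/mem_glue => c.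
  by rewrite push_proj_wact rpredZ.
by rewrite limg_dim_eq // (eqP (lker_wact _ _ _ (svalP t))) capv0.
Qed.

Definition of_cover (y : Union) : fixed_locus (S := Gr) act :=
  exist _ (glue_point (projT2 y)) (@glue_point_fixed (projT1 y) (projT2 y)).

(** The subspaces determine their dimensions, hence the index of the piece; the remaining data are
    proofs. *)
Lemma Union_eq (y y' : Union) :
  (forall v, sval (projT2 y) v = sval (projT2 y') v) -> y = y'.
Proof.
case: y y' => [[e1 h1] Y1] [[e2 h2] Y2] /= YY.
have e12 : e1 = e2.
  apply/fsfunP => v; have [_ /(_ v) <-] := svalP Y1.
  by have [_ /(_ v) <-] := svalP Y2; rewrite YY.
subst e2; have h12 : h1 = h2 by exact: Prop_irrelevance.
by subst h2; congr existT; exact: gr_point_eq.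
Qed.

Lemma to_coverK : cancel to_cover of_cover.
Proof.
move=> [U fixU]; apply: eq_exist; apply: gr_point_eq => i /=.
by apply: componentK; exact: fixed_point_graded.
Qed.

Lemma of_coverK : cancel of_cover to_cover.
Proof. by move=> y; apply: Union_eq => v /=; exact: glueK. Qed.

(** On each piece, local frames at the vertices of the support are concatenated. Each vector of the
    result keeps the multidegree of the covering vertex from which it comes. *)
Lemma of_cover_morphism : space_morphism of_cover.
Proof.
apply: space_morphism_copair => e'; apply: local_morphism => Y0.
have supp0 := cover_dim_supp Y0; have sum0 := cover_dim_sum Y0.
have homX : hhomog (quiverGr X (sval e')).
  by refine (@hhomog_quiverGr _ _ _ _ (supp X) _ _); rewrite ?fset_uniq.
have [b0 Yb0] := hlift_exists Y0.
have [n [g [W [hg g0 gW hW]]]] := local_frames (supp X) Yb0.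
pose tau (b : frames X (sval e')) : frames (push X) e :=
  fun i => glue_frame (sum0 i) (W b).
exists (sublocus (S := Gr) fixed), id, g, tau.
have [|||_ hM] := @frames_pullback _ _ _ _ (quiverGr X (sval e')) (vertices Q) tau
  (fun i k v => (v == (i, val (tag (glue_ord (sum0 i) k)))) : nat) fixed.
- exact: vertices_uniq.
- by move=> i; rewrite mem_vertices.
- move=> i k l; set c := tag _.
  have h := hvec_lfun (push_in X i (val c)) (hW (i, val c) (tagged (glue_ord (sum0 i) k))).
  by apply: hpoly_eq (h l) _ _ => // b; rewrite tnth_mktuple.
eexists; split; [exact/hhomog_sublocus/hhomog_push|by split|exact: hM| |].
- exact: unit_at_homog homX hg Yb0 g0.
- move=> Y b Yb gb; exists (of_cover (existT _ e' Y)) => // i /=.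
  apply: glue_frame_basis => c; apply: gW => //.
  by rewrite -mem_supp_fiber; exact: valP.
Qed.

(** The projected frame spans the component. A selection [f] of its vectors that is a basis at [U0]
    is kept for nearby points, where a minor [h] guarantees freeness. Only a lower bound on nearby
    dimensions follows. *)
Lemma component_frame (U0 : hpoint Gr) b0 (g : frames (push X) e -> K)
    (W : frames (push X) e -> frames (push X) e) v :
  fixed U0 -> @hlift _ Gr U0 b0 -> g b0 != 0 ->
  (forall U b, @hlift _ Gr U b -> g b != 0 ->
     forall i, i \in vertices Q -> basis_of (sval U i) (W b i)) ->
  (forall i j, @hvec _ Gr _ (fun k => (k == i) : nat) (fun b => tnth (W b i) j)) ->
  exists n (h : frames (push X) e -> K)
      (T : frames (push X) e -> (component_dim U0 v).-tuple (X v)),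
    [/\ @hpoly _ Gr n h, h b0 != 0,
        forall U b, fixed U -> @hlift _ Gr U b -> g b != 0 -> h b != 0 ->
          free (T b) /\ {subset T b <= component (sval U) v} &
        forall j, @hvec _ Gr _ (fun k => (k == v.1) : nat) (fun b => tnth (T b) j)].
Proof.
move=> fix0 Ub0 g0 gW hW.
have [vX|vX] := boolP (v \in supp X); last first.
  have dim0 := component_dim_supp U0 vX.
  exists (fun=> 0%N), (fun=> 1), (fun=> [tuple 0 | j < component_dim U0 v]).
  split; [exact: hpoly_const|exact: oner_neq0| |].
    by move=> U b _ _ _ _; exact: tuple_size0_free.
  by move=> j; have := ltn_ord j; rewrite {2}dim0.
case: v vX => i c ic; have ci : c \in supp_fiber X i by rewrite mem_supp_fiber.
pose p : 'Hom(push X i, X (i, c)) := push_proj [` ci]%fset.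
pose Y b := [tuple of map p (W b i)].
have spanY U b : fixed U -> @hlift _ Gr U b -> g b != 0 ->
    <<Y b>>%VS = component (sval U) (i, c).
  move=> fixU Ub gb; rewrite -graded_component_img; last exact: fixed_point_graded.
  by rewrite -limg_span (span_basis (gW _ _ Ub gb _ _)) ?mem_vertices.
have [f fY] : exists f : 'I_(component_dim U0 (i, c)) -> 'I_(e i),
    row_free (rowsub f (coord_mx (Y b0))).
  by apply: row_free_rowsub; rewrite mxrank_coord_mx (spanY _ _ fix0) // component_dimE.
pose T b := [tuple tnth (Y b) (f j) | j < component_dim U0 (i, c)].
have TE b : coord_mx (T b) = rowsub f (coord_mx (Y b)).
  by apply/matrixP => j k; rewrite !mxE tnth_mktuple.
have hT j : @hvec _ Gr _ (fun k => (k == i) : nat) (fun b => tnth (T b) j).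
  move=> l; apply: hpoly_eq (hvec_lfun p (hW i (f j)) l) _ _ => // b.
  by rewrite tnth_mktuple tnth_map.
have [I hI] := row_free_minor fY.
exists (fun k => \sum_(j < component_dim U0 (i, c)) (k == i))%N.
exists (fun b => \det (colsub I (coord_mx (T b)))), T; split=> //.
- apply: hpoly_det => j k.
  by apply: hpoly_eq (hvec_coord (vbasis {:X (i, c)}) (I k) (hT j)) _ _ => // b; rewrite !mxE.
- by rewrite TE.
- move=> U b fixU Ub gb /det_colsub_row_free; rewrite -free_coord_mx; split=> //.
  move=> _ /tnthP[j ->]; rewrite -(spanY U b) // tnth_mktuple.
  by apply/memv_span/mem_tnth.
Qed.

(** Here [iota] is the inclusion of the piece [e0] containing the image of [x0], so nearby fixed
    points must be shown to have the same graded dimensions. *)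
Lemma to_cover_morphism : space_morphism to_cover.
Proof.
apply: local_morphism => x0; pose U0 := sval x0.
have fix0 : fixed U0 := svalP x0.
have [b0 Ub0] := hlift_exists U0.
have [n [g [W [hg g0 gW hW]]]] := local_frames (vertices Q) Ub0.
have ex v := component_frame v fix0 Ub0 g0 gW hW.
pose N v := projT1 (cid (ex v)).
pose h v := projT1 (cid (projT2 (cid (ex v)))).
pose T v := projT1 (cid (projT2 (cid (projT2 (cid (ex v)))))).
have hT v := projT2 (cid (projT2 (cid (projT2 (cid (ex v)))))).
have {}hT v : [/\ @hpoly _ Gr (N v) (h v), h v b0 != 0,
        forall U b, fixed U -> @hlift _ Gr U b -> g b != 0 -> h v b != 0 ->
          free (T v b) /\ {subset T v b <= component (sval U) v} &
        forall j, @hvec _ Gr _ (fun k => (k == v.1) : nat) (fun b => tnth (T v b) j)].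
  exact: hT.
pose e0 : cover_dim := exist _ (component_dim U0) (component_dim_compatible fix0).
pose S := sublocus (S := Gr) fixed.
pose G b := g b * \prod_(v <- supp X) h v b.
have hG : @hpoly _ Gr (fun k => n k + \sum_(v <- supp X) N v k)%N G.
  by apply: hpoly_mul hg _; apply: hpoly_prod => v; have [] := hT v.
have GE b : G b != 0 -> g b != 0 /\ forall v, v \in supp X -> h v b != 0.
  rewrite mulf_eq0 negb_or prodf_seq_neq0 => /andP[gb /allP hb].
  by split=> // v vX; exact: (hb v vX).
pose tau (b : frames (push X) e) : frames X (sval e0) := fun v => T v b.
exists (quiverGr X (sval e0)), (existT _ e0), G, tau.
have [|||hM _] := @frames_pullback _ _ _ (sval e0) S (supp X) tau
  (fun v _ k => (k == v.1) : nat) (fun=> True).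
- exact: fset_uniq.
- exact: component_dim_supp.
- by move=> v j; apply: hvec_sublocus; have [_ _ _] := hT v; apply.
eexists; split; [|split|exact: hM| |].
- refine (@hhomog_quiverGr _ _ _ _ (supp X) _ _); first exact: fset_uniq.
  exact: component_dim_supp.
- exact: (@space_morphism_inclusion _ _ (fun e' : cover_dim => variety (quiverGr X (sval e')))).
- move=> Y1 Y2 Y12; apply: gr_point_eq => v.
  exact: (congr1 (fun y : Union => sval (projT2 y) v) Y12).
- apply: (@unit_at_homog _ S x0 _ _ b0 _ (proj1 (hpoly_sublocus fixed _ _) hG)) => //.
    exact/hhomog_sublocus/hhomog_push.
  rewrite mulf_neq0 // prodf_seq_neq0; apply/allP => v _.
  by have [] := hT v.
move=> x b xb /GE[gb hb]; pose U := sval x; have fixU : fixed U := svalP x.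
have Tb v : free (T v b) /\ {subset T v b <= component (sval U) v}.
  have [vX|vX] := boolP (v \in supp X).
    by have [_ _ + _] := hT v; apply => //; exact: hb.
  by apply: tuple_size0_free; exact: component_dim_supp.
(* Semicontinuity: the free family [T v b] lies in the component. *)
have le0 v : (component_dim U0 v <= \dim (component (sval U) v))%N.
  have [freeT subT] := Tb v; rewrite -[X in (X <= _)%N](size_tuple (T v b)).
  by move: freeT => /eqP <-; apply/dimvS/span_subvP.
have dimU v : \dim (component (sval U) v) = component_dim U0 v.
  have [vX|vX] := boolP (v \in supp X); last first.
    by rewrite -component_dimE !component_dim_supp.
  case: v vX => i c ic; have ci : c \in supp_fiber X i by rewrite mem_supp_fiber.
  (* Both sides sum to [e i] over the fiber, so every termwise inequality is an equality. *)
  have /leqif_sum[_] : forall c : supp_fiber X i, true ->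
      (component_dim U0 (i, val c) <= \dim (component (sval U) (i, val c))
       ?= iff (component_dim U0 (i, val c) == \dim (component (sval U) (i, val c))))%N.
    by move=> c' _; apply: leqif_eq.
  rewrite sum_dim_component // -(sum_dim_component i fix0).
  under [X in X == _]eq_bigr do rewrite component_dimE.
  by rewrite eqxx => /esym/forallP/(_ [` ci]%fset)/eqP /= ->.
pose Y : gr_point X (sval e0) :=
  exist _ (component (sval U)) (conj (proj1 (component_point_proof U)) dimU).
exists Y; first exact: Union_eq.
move=> v; have [freeT subT] := Tb v.
by rewrite basisEfree freeT size_tuple dimU leqnn andbT; apply/span_subvP.
Qed.

Lemma fixed_locus_isomorphic : isomorphic (fixed_locus (S := Gr) act) Union.
Proof.
exists to_cover, of_cover.
split; [exact: to_coverK|exact: of_coverK|exact: to_cover_morphism|exact: of_cover_morphism].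
Qed.

End FixedLocus.

Theorem theorem1 (R : realType) (Q : finQuiver) (hQ : acyclic Q)
    (X' : fdrep R[i] (coverQuiver Q)) :
  exists d : supp X' -> int,
    forall e : vertex Q -> nat,
      exists act : Gm R[i] -> hpoint (quiverGr (push X') e) ->
                   hpoint (quiverGr (push X') e),
        (forall (t : Gm R[i]) (U : hpoint (quiverGr (push X') e))
            (i : vertex Q),
           sval (act t U) i = (weight_act d (sval t) i @: sval U i)%VS) /\
        algebraic_Gm_action act /\
        isomorphic (fixed_locus act)
          (disjoint_union
             (fun e' : {e' : {fsfun vertex (coverQuiver Q) -> nat with 0%N}
                           | compatible e e'} =>
                variety (quiverGr X' (sval e')))).
Proof.
have [w [d [k [wD dI dk]]]] := separating_weight [fset v.2 | v in supp X']%fset.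
have suppE v : v \in supp X' -> v.2 \in [fset v.2 | v in supp X']%fset.
  by move=> vX; apply: in_imfset.
(* The constant [k] cancels, and additivity of [w] leaves a shift depending on the arrow alone. *)
have dw a c : (fsrc a, c) \in supp X' -> (ftgt a, c + char_gen a) \in supp X' ->
    (d (c + char_gen a))%:Z = (d c)%:Z + w (char_gen a).
  by move=> /suppE /= cX /suppE /= cX'; rewrite !dk // wD addrAC.
have dIX i : {in supp_fiber X' i &, injective d}.
  by move=> c c'; rewrite !mem_supp_fiber => /suppE /= cX /suppE /= cX'; exact: dI.
exists (push_weight d) => e; exists (gm_act (w := fun a => w (char_gen a)) dw); split=> //.
by split; [exact: gm_act_algebraic|exact: fixed_locus_isomorphic].
Qed.
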